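(* Let $a,b\ge2$ be integers, and put $s=\lceil a/b\rceil$ and $m=a-s$. The map \[ \beta(x_1,\ldots,x_a)=(x_{s+1}-s,\ldots,x_a-s) \] is an order isomorphism from the poset of below-diagonal rational $(a,b)$-Dyck paths (written in horizontal-step coordinates) to the staircase \[ \Omega_{a,b}=\{(z_1,\ldots,z_m): 1\le z_1<\cdots<z_m,\ z_j\le H_j^{a,b}\text{ for }1\le j\le m\},\qquad H_j^{a,b}=j+\left\lfloor\frac{b(s+j-1)}{a}\right\rfloor, \] ordered coordinatewise.
   Context: A below-diagonal rational $(a,b)$-Dyck path is a north-east lattice path from $(0,0)$ to $(a,b)$ such that every point $(p,q)$ on it satisfies $q\le\frac ba p$. Number its $a+b$ steps consecutively $1,\ldots,a+b$; the path is encoded by the increasing sequence $(x_1<\cdots<x_a)$ of the labels of its horizontal steps. The poset $\operatorname{Dyck}^{\mathrm{below}}_{a,b}$ of such paths carries the coordinatewise order: $x\le x'$ iff $x_i\le x_i'$ for all $i$. *)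

(* Defs.v *)
From HB Require Import structures.
From mathcomp Require Import all_boot all_order all_algebra.

Set Implicit Arguments.
Unset Strict Implicit.
Unset Printing Implicit Defensive.

Import Order.TTheory GRing.Theory Num.Theory.

(* A north-east path from (0,0) to (a,b) is the word of its a + b steps, with
   [true] for a horizontal (east) and [false] for a vertical (north) step.
   Having a horizontal steps among a + b, it has b vertical ones. *)
Definition hcount (w : seq bool) (k : nat) : nat := count_mem true (take k w).
Definition vcount (w : seq bool) (k : nat) : nat := count_mem false (take k w).

(* (hcount w k, vcount w k) is the lattice point reached after k steps. *)
Definition below_diagonal (a b : nat) (w : seq bool) : bool :=
  [forall k : 'I_(a + b).+1,
    ((vcount w k)%:R <= b%:R / a%:R * (hcount w k)%:R :> rat)%R].

Definition is_below_dyck (a b : nat) (w : (a + b).-tuple bool) : bool :=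
  (count_mem true w == a) && below_diagonal a b w.

Record below_dyck (a b : nat) := BelowDyck {
  steps :> (a + b).-tuple bool;
  _ : is_below_dyck steps
}.

HB.instance Definition _ (a b : nat) := [isSub for @steps a b].
HB.instance Definition _ (a b : nat) := [Choice of below_dyck a b by <:].

Lemma size_hlabels (a b : nat) (P : below_dyck a b) :
  size (mask P (iota 1 (a + b))) == a.
Proof.
rewrite size_mask ?size_tuple ?size_iota //.
have /andP[/eqP Pa _] := valP P.
by apply/eqP; rewrite -[RHS]Pa; apply: eq_count; case.
Qed.

(* The labels, in 1, ..., a + b, of the horizontal steps of P.  The type
   [n.-tupleprod nat] is [n.-tuple nat] with the coordinatewise order. *)
Definition hlabels (a b : nat) (P : below_dyck a b) : a.-tupleprod nat :=
  Tuple (size_hlabels P).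

Lemma mask_inj (T : eqType) (s : seq T) (v w : seq bool) :
  uniq s -> size v = size s -> size w = size s ->
  mask v s = mask w s -> v = w.
Proof.
elim: s v w => [|x s IHs] [|c v] [|d w] //= /andP[xs us] [sv] [sw].
have xv u : x \notin mask u s by apply: contra xs; apply: mem_mask.
case: c d => [] [] /=.
- by case=> /(IHs _ _ us sv sw) ->.
- by move=> e; have := xv w; rewrite -e mem_head.
- by move=> e; have := xv v; rewrite e mem_head.
- by move/(IHs _ _ us sv sw) ->.
Qed.

Lemma hlabels_inj (a b : nat) : injective (@hlabels a b).
Proof.
move=> P Q /(congr1 val) /= e; apply/val_inj/val_inj.
by apply: mask_inj e; rewrite ?iota_uniq ?size_tuple ?size_iota.
Qed.

Definition dyck_le (a b : nat) (P Q : below_dyck a b) : bool :=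
  (hlabels P <= hlabels Q)%O.

Lemma dyck_le_refl (a b : nat) : reflexive (@dyck_le a b).
Proof. by move=> P; apply: lexx. Qed.

Lemma dyck_le_anti (a b : nat) : antisymmetric (@dyck_le a b).
Proof. by move=> P Q /le_anti /hlabels_inj. Qed.

Lemma dyck_le_trans (a b : nat) : transitive (@dyck_le a b).
Proof. by move=> Q P S; apply: le_trans. Qed.

Fact dyck_display : Order.disp_t. Proof. exact: Order.Disp tt tt. Qed.

HB.instance Definition _ (a b : nat) :=
  Order.Le_isPOrder.Build dyck_display (below_dyck a b)
    (@dyck_le_refl a b) (@dyck_le_anti a b) (@dyck_le_trans a b).

Definition ceil_ratio (a b : nat) : nat :=
  `|Num.ceil (a%:R / b%:R : rat)%R|%N.

Definition staircase_bound (a b j : nat) : nat := j + (b * (ceil_ratio a b + j - 1)) %/ a.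

(* [path ltn 0 z] says 1 <= z_1 < ... < z_m, and [tnth z j] is z_(j+1). *)
Definition in_staircase (a b : nat) (z : (a - ceil_ratio a b).-tupleprod nat) :
    bool :=
  path ltn 0 z &&
    [forall j : 'I_(a - ceil_ratio a b), tnth z j <= staircase_bound a b j.+1].

Record staircase (a b : nat) := Staircase {
  coords :> (a - ceil_ratio a b).-tupleprod nat;
  _ : in_staircase coords
}.

Fact staircase_display : Order.disp_t. Proof. exact: Order.Disp tt tt. Qed.

HB.instance Definition _ (a b : nat) := [isSub for @coords a b].
HB.instance Definition _ (a b : nat) := [Choice of staircase a b by <:].
HB.instance Definition _ (a b : nat) :=
  [SubChoice_isSubPOrder of staircase a b by <: with staircase_display].

(* The sequence (x_(s+1) - s, ..., x_a - s). *)
Definition beta (a s : nat) (x : a.-tuple nat) : (a - s).-tuple nat :=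
  [tuple of [seq y - s | y <- drop s x]].

(* Main.v *)
(* A horizontal step x_i is preceded by i - 1 horizontal and x_i - i vertical
   steps, and staying below the diagonal need only be tested just before
   horizontal steps.  So below-diagonal paths are the increasing positive
   sequences with x_i <= i + floor(b(i-1)/a).  For i <= s the floor vanishes,
   which forces x_i = i; beta drops these forced entries and loses nothing. *)
Require Import Defs.
From mathcomp Require Import all_boot all_order all_algebra.
From mathcomp Require Import zify.

Set Implicit Arguments.
Unset Strict Implicit.
Unset Printing Implicit Defensive.

Import Order.TTheory GRing.Theory Num.Theory.

(** * Label sequences: counting and strict increase *)

Lemma count_leq_mask_iota (w : seq bool) (m k : nat) :
  count (leq^~ (m + k)) (mask w (iota m.+1 (size w))) =
  count_mem true (take k w).
Proof.
(* The offset [m] is general because passing the first letter shifts every later label by one. *)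
elim: w m k => [|c w IHw] m [|k] //.
  rewrite addn0 take0; apply/eqP; rewrite -leqn0 leqNgt -has_count.
  by apply/hasPn => y /mem_mask; rewrite mem_iota -ltnNge => /andP[].
rewrite /= addnS -addSn -(IHw m.+1 k).
by case: c; rewrite //= addSn ltnS leq_addr.
Qed.

(** In an increasing sequence the entries at most [k] form a prefix, and their number is its length.
    This trades bounds on labels for counts of steps. *)
Lemma nth_leq_count (s : seq nat) (i k : nat) :
  sorted ltn s -> i < size s ->
  (nth 0 s i <= k) = (i < count (leq^~ k) s).
Proof.
elim: s i => [|y s IHs] //= i pys.
have ys : all (ltn y) s by apply: order_path_min pys; apply: ltn_trans.
case: (leqP y k) => [yk|ky].
  by case: i => [|i] //=; rewrite ltnS => /(IHs _ (path_sorted pys)) ->.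
have -> : count (leq^~ k) s = 0.
  apply/eqP; rewrite -leqn0 leqNgt -has_count; apply/hasPn => z zs.
  by rewrite -ltnNge; apply: ltn_trans ky (allP ys z zs).
case: i => [|i] /=; first by move=> _; rewrite leqNgt ky.
rewrite ltnS => /(mem_nth 0)/(allP ys)/= yz.
by rewrite leqNgt (ltn_trans ky yz).
Qed.

Lemma path_ltn_addn_leq_nth (s : seq nat) (m i : nat) :
  path ltn m s -> i < size s -> m + i < nth 0 s i.
Proof.
elim: s m i => [|y s IHs] //= m [|i] /andP[my pys]; first by rewrite addn0.
by rewrite ltnS => /(IHs _ _ pys) /=; lia.
Qed.

Lemma path_ltn_mask_iota (w : seq bool) (m n : nat) :
  path ltn m (mask w (iota m.+1 n)).
Proof.
apply: (subseq_path ltn_trans (s2 := iota m.+1 n)).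
  exact: mask_subseq.
by elim: n m => //= n IHn m; rewrite ltnSn IHn.
Qed.

(** * The diagonal condition and the ratio as integer inequalities *)

Lemma below_diagonalP (a b : nat) (w : seq bool) :
  0 < a -> size w = a + b -> count_mem true w = a ->
  reflect (forall i, i < a ->
             nth 0 (mask w (iota 1 (a + b))) i <= i.+1 + (b * i) %/ a)
          (below_diagonal a b w).
Proof.
move=> a0 sw cw; set x := mask _ _.
have px : path ltn 0 x by apply: path_ltn_mask_iota.
have sx : size x = a.
  rewrite size_mask ?sw ?size_iota // -[RHS]cw.
  by apply: eq_count; case.
have hE k : hcount w k = count (leq^~ k) x.
  by rewrite /x -sw /hcount -(count_leq_mask_iota w 0).
have vE k : k <= a + b -> vcount w k + hcount w k = k.
  move=> kn; rewrite /vcount /hcount -[RHS](size_takel (s := w)) ?sw //.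
  rewrite addnC -(count_predC (pred1 true)); congr (_ + _).
  by apply: eq_count; case.
have ratE k : ((vcount w k)%:R <= b%:R / a%:R * (hcount w k)%:R :> rat)%R =
    (vcount w k <= (b * hcount w k) %/ a).
  rewrite mulrAC ler_pdivlMr ?ltr0n // -!natrM ler_nat.
  by rewrite leq_divRL.
apply: (iffP forallP) => [dw i ia|xb [k /= kn]]; last first.
  rewrite ratE; move: (vE k); rewrite -ltnS => /(_ kn) vk.
  have ha : hcount w k <= a by rewrite hE -sx count_size.
  (* If [h = hcount w k] is below [a], entry [h] of [x] is the first label beyond [k]; its bound
     gives [k - h <= (b * h) %/ a], and [k - h] is the vertical count. If [h = a], the floor is
     [b]. *)
  case: (ltnP (hcount w k) a) => [hlt|hge].
    have := xb _ hlt.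
    have : k < nth 0 x (hcount w k).
      by rewrite ltnNge nth_leq_count ?(path_sorted px) ?sx // -hE ltnn.
    by lia.
  have -> : hcount w k = a by lia.
  by rewrite mulnK //; lia.
have xi : i < nth 0 x i.
  by rewrite -[X in X < _]add0n path_ltn_addn_leq_nth ?sx.
have xn : nth 0 x i <= a + b.
  have /mem_mask : nth 0 x i \in x by rewrite mem_nth ?sx.
  by rewrite mem_iota; lia.
(* Test the point just before the step labelled [nth 0 x i]. At most [i] horizontal steps precede
   it, and the bound is monotone in that number. *)
have kn : (nth 0 x i).-1 < (a + b).+1 by lia.
have := dw (Ordinal kn); rewrite ratE /=.
have hi : hcount w (nth 0 x i).-1 <= i.
  by rewrite hE leqNgt -nth_leq_count ?(path_sorted px) ?sx //; lia.
have /(leq_div2r a) : b * hcount w (nth 0 x i).-1 <= b * i.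
  by rewrite leq_mul2l hi orbT.
have := vE (nth 0 x i).-1; lia.
Qed.

Lemma ltn_ceil_ratio (a b i : nat) : 0 < b -> (i < ceil_ratio a b) = (i * b < a).
Proof.
move=> b0; rewrite /ceil_ratio.
(* Nonnegativity makes the absolute value in [ceil_ratio] harmless. *)
have c0 : (0 <= Num.ceil (a%:R / b%:R : rat))%R.
  by rewrite ceil_ge0 (@lt_le_trans _ _ 0%R) ?divr_ge0 ?ler0n ?ltrN10.
rewrite -ltz_nat gez0_abs // ceil_gt_int.
by rewrite ltr_pdivlMr ?ltr0n // -[_%:~R%R]/(i%:R)%R -natrM ltr_nat.
Qed.

Lemma below_dyck_leE (a b : nat) (P Q : below_dyck a b) :
  (P <= Q)%O = (hlabels P <= hlabels Q)%O.
Proof. by []. Qed.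

(** * Recovering a path from its labels *)

Lemma mask_mem_iota (n : nat) (x : seq nat) :
  path ltn 0 x -> {in x, forall y, y <= n} ->
  mask [seq y \in x | y <- iota 1 n] (iota 1 n) = x.
Proof.
move=> px xn; rewrite -filter_mask.
have x0 : all (ltn 0) x by apply: order_path_min px; apply: ltn_trans.
(* Two strictly increasing lists with the same members are equal. *)
apply: (irr_sorted_eq ltn_trans ltnn).
- exact/(sorted_filter ltn_trans)/iota_ltn_sorted.
- exact: path_sorted px.
move=> y; rewrite mem_filter mem_iota add1n ltnS.
by case yx: (y \in x) => //=; rewrite (xn y yx) andbT; apply: (allP x0).
Qed.

Lemma below_dyck_of_labels (a b : nat) (x : seq nat) :
  0 < a -> size x = a -> path ltn 0 x ->
  (forall i, i < a -> nth 0 x i <= i.+1 + (b * i) %/ a) ->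
  {P : below_dyck a b | hlabels P = x :> seq nat}.
Proof.
move=> a0 sx px xb.
have xn : {in x, forall y, y <= a + b}.
  move=> y /(nthP 0)[i]; rewrite sx => ia <-.
  (* The label is at most [i.+1 <= a] plus a floor of at most [b], so it names one of the [a + b]
     steps. *)
  have := xb i ia; have : (b * i) %/ a <= (b * a) %/ a.
    by rewrite leq_div2r // leq_mul2l (ltnW ia) orbT.
  by rewrite mulnK // => qb /leq_trans; apply; lia.
set w := [seq y \in x | y <- iota 1 (a + b)].
have wE : mask w (iota 1 (a + b)) = x by apply: mask_mem_iota.
have sw : size w == a + b by rewrite size_map size_iota.
have cw : count_mem true w = a.
  rewrite -sx -wE size_mask ?(eqP sw) ?size_iota //.
  by apply: eq_count; case.
have dw : is_below_dyck (Tuple sw).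
  rewrite /is_below_dyck cw eqxx /=.
  by apply/below_diagonalP; rewrite ?(eqP sw) // wE.
by exists (BelowDyck dw).
Qed.

(** * The map to the staircase, its order and its inverse *)

Section Beta.

Variables a b : nat.
Hypotheses (a0 : 0 < a) (b0 : 0 < b).
Let s := ceil_ratio a b.

Local Notation labels P := (mask (steps P) (iota 1 (a + b))).

Lemma ceil_ratio_leq : s <= a.
Proof. by rewrite leqNgt ltn_ceil_ratio //; nia. Qed.

Lemma path_hlabels (P : below_dyck a b) : path ltn 0 (labels P).
Proof. exact: path_ltn_mask_iota. Qed.

Lemma nth_hlabels_ltn (P : below_dyck a b) (i : nat) :
  i < a -> i < nth 0 (labels P) i.
Proof.
move=> ia; rewrite -[X in X < _]add0n.
by rewrite path_ltn_addn_leq_nth ?path_hlabels ?(eqP (size_hlabels P)).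
Qed.

Lemma nth_hlabels_leq (P : below_dyck a b) (i : nat) :
  i < a -> nth 0 (labels P) i <= i.+1 + (b * i) %/ a.
Proof.
have /andP[/eqP cP dP] := valP P.
by move: i; apply/below_diagonalP; rewrite ?size_tuple.
Qed.

Lemma nth_hlabels_forced (P : below_dyck a b) (i : nat) :
  i < s -> nth 0 (labels P) i = i.+1.
Proof.
move=> is_; have ia := leq_trans is_ ceil_ratio_leq.
have := nth_hlabels_ltn P ia; have := nth_hlabels_leq P ia.
by rewrite divn_small ?[b * i]mulnC -?ltn_ceil_ratio //; lia.
Qed.

Lemma nth_beta (P : below_dyck a b) (j : nat) :
  j < a - s -> nth 0 (beta s (hlabels P)) j = nth 0 (labels P) (s + j) - s.
Proof.
move=> ja; rewrite (nth_map 0) ?nth_drop // size_drop.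
by have /eqP -> := size_hlabels P.
Qed.

Lemma staircase_boundS (j : nat) :
  staircase_bound a b j.+1 = j.+1 + (b * (s + j)) %/ a.
Proof. by rewrite /staircase_bound -/s addnS subSS subn0. Qed.

Lemma path_beta (P : below_dyck a b) : path ltn 0 (beta s (hlabels P)).
Proof.
apply/(pathP 0) => j; rewrite size_tuple => jm.
have sj : s + j < a by lia.
(* Truncated subtraction of [s] keeps the inequality strict because this label exceeds [s + j],
   hence [s]. *)
have lt_sj := nth_hlabels_ltn P sj.
case: j jm sj lt_sj => [|j] jm sj lt_sj;
  rewrite [nth 0 (0 :: _) _]/= !nth_beta //; try lia.
have sj' : s + j < a by lia.
have := nth_hlabels_ltn P sj'.
have /(sortedP 0)/(_ (s + j)) := path_sorted (path_hlabels P).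
by rewrite (eqP (size_hlabels P)) -addnS => /(_ sj); lia.
Qed.

Lemma in_staircase_beta (P : below_dyck a b) :
  in_staircase (b := b) (beta s (hlabels P)).
Proof.
have sa := ceil_ratio_leq.
apply/andP; split; first exact: path_beta.
apply/forallP => j; rewrite (tnth_nth 0) nth_beta //.
have sj : s + j < a by have := ltn_ord j; rewrite -/s; lia.
rewrite staircase_boundS leq_subLR addnA addnS; exact: nth_hlabels_leq.
Qed.

Definition dyck_to_staircase (P : below_dyck a b) : staircase a b :=
  Staircase (in_staircase_beta P).

Lemma dyck_to_staircase_mono : {mono dyck_to_staircase : P Q / (P <= Q)%O}.
Proof.
move=> P Q; have sa := ceil_ratio_leq.
rewrite -Order.le_val below_dyck_leE !leEtprod.
apply/idP/idP => /forallP le; apply/forallP => i; rewrite !(tnth_nth 0) !leEnat.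
  (* Before index [s] all paths share the same labels; from there on labels exceed [s], so
     subtracting [s] reflects the order. *)
  have ia := ltn_ord i; case: (ltnP i s) => [is_|si].
    by rewrite !nth_hlabels_forced.
  have jm : i - s < a - s by lia.
  have := le (Ordinal jm); rewrite !(tnth_nth 0) leEnat /=.
  rewrite !nth_beta // subnKC //.
  by have := nth_hlabels_ltn P ia; have := nth_hlabels_ltn Q ia; lia.
have si : s + i < a by have := ltn_ord i; rewrite -/s; lia.
rewrite !nth_beta ?leq_sub2r //.
by have := le (Ordinal si); rewrite !(tnth_nth 0).
Qed.

(** Shift [z] up by [s] and put the forced labels [1, ..., s] back in front. The sigma type lets its
    first projection serve as the inverse map. *)
Lemma dyck_to_staircase_surj (z : staircase a b) :
  {P : below_dyck a b | dyck_to_staircase P = z}.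
Proof.
have sa := ceil_ratio_leq.
have /andP[pz /forallP zb] := valP z.
pose zs : seq nat := tval (coords z).
have sz : size zs = a - s by rewrite size_tuple.
pose x := iota 1 s ++ [seq s + y | y <- zs].
have sx : size x = a by rewrite size_cat size_map size_iota sz subnKC.
have nx i : i < a ->
    nth 0 x i = if i < s then i.+1 else s + nth 0 zs (i - s).
  move=> ia; rewrite nth_cat size_iota; case: ltnP => si.
    by rewrite nth_iota.
  by rewrite (nth_map 0) // sz; lia.
have px : path ltn 0 x.
  rewrite cat_path; apply/andP; split.
    by have := path_ltn_mask_iota (nseq s true) 0 s; rewrite mask_true ?size_iota.
  (* Written as [s + 0], the starting value is the shift of [0], so the remaining path condition is
     that of [z] translated by [s]. *)
  have -> : last 0 (iota 1 s) = s + 0.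
    by rewrite addn0 (last_nth 0) size_iota -[_ :: _]/(iota 0 s.+1) nth_iota.
  by rewrite (mono_path (e := ltn)) // => u v; apply: ltn_add2l.
have xb i : i < a -> nth 0 x i <= i.+1 + (b * i) %/ a.
  move=> ia; rewrite nx //; case: ltnP => si; first exact: leq_addr.
  have jm : i - s < a - s by lia.
  have zi : nth 0 zs (i - s) <= (i - s).+1 + (b * i) %/ a.
    by have := zb (Ordinal jm); rewrite (tnth_nth 0) staircase_boundS /= subnKC.
  by lia.
have [P PE] := below_dyck_of_labels a0 sx px xb.
exists P; do 2!apply: val_inj; rewrite /= -/s.
have -> : mask P (iota 1 (a + b)) = x by [].
rewrite drop_size_cat ?size_iota // -map_comp -[RHS]map_id.
by apply: eq_map => y /=; rewrite addKn.
Qed.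

End Beta.

Theorem proposition5p4 (a b : nat) (ha : 2 <= a) (hb : 2 <= b) :
  exists f : below_dyck a b -> staircase a b,
    [/\ forall P : below_dyck a b,
          coords (f P) = beta (ceil_ratio a b) (hlabels P),
        bijective f
      & {mono f : P Q / (P <= Q)%O}].
Proof.
have a0 : 0 < a by apply: ltnW.
have b0 : 0 < b by apply: ltnW.
have mono := dyck_to_staircase_mono a0 b0.
exists (dyck_to_staircase a0 b0); split=> //.
pose g z := sval (dyck_to_staircase_surj a0 b0 z).
have gK : cancel g (dyck_to_staircase a0 b0).
  by move=> z; apply: svalP (dyck_to_staircase_surj a0 b0 z).
(* Reflecting a partial order forces injectivity, so the right inverse [g] is two-sided. *)
by exists g => //; apply: inj_can_sym gK (inc_inj mono).
Qed.
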